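(* Let $G$ be a graph on $n$ nodes with $m$ edges. Then $\sum_{i=1}^k\lambda_i(G)\le m+\binom{k+1}{2}$ holds for every $k\in\{1,\dots,n\}$ if and only if $G$ is spectrally threshold dominated.
   Context: All graphs are finite and simple. For a graph $G$ on $n$ nodes, the Laplacian eigenvalues (eigenvalues of $L(G)=D(G)-A(G)$) are $\lambda_1(G)\ge\dots\ge\lambda_n(G)=0$. A threshold graph is a graph obtainable from the empty graph by repeatedly adding a new node that is either isolated or adjacent to all previously added nodes. A graph $G$ on $n$ nodes with $m$ edges is spectrally threshold dominated if for each $k\in\{1,\dots,n\}$ there is a threshold graph $T_k$ on $n$ nodes with $m$ edges satisfying $\sum_{i=1}^k\lambda_i(T_k)\ge\sum_{i=1}^k\lambda_i(G)$. *)

(* Defs.v *)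
From Stdlib Require Import ClassicalEpsilon.
From mathcomp Require Import all_boot all_order all_algebra all_fingroup.
Set Implicit Arguments. Unset Strict Implicit. Unset Printing Implicit Defensive.
Import Order.TTheory GRing.Theory Num.Theory.
Local Open Scope ring_scope.

Definition simple_graph (n : nat) (e : rel 'I_n) : Prop :=
  symmetric e /\ irreflexive e.

Definition nedges (n : nat) (e : rel 'I_n) : nat :=
  #|[set p : 'I_n * 'I_n | (p.1 < p.2)%N && e p.1 p.2]|.

Definition degree (n : nat) (e : rel 'I_n) (i : 'I_n) : nat := #|[set j | e i j]|.

Definition laplacian (R : nzRingType) (n : nat) (e : rel 'I_n) : 'M[R]_n :=
  \matrix_(i, j) (if i == j then (degree e i)%:R else - (e i j)%:R).

Definition is_desc_spectrum (R : rcfType) (n : nat) (A : 'M[R]_n) (s : seq R) : Prop :=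
  sorted (fun x y : R => y <= x) s /\
  char_poly A = \prod_(x <- s) ('X - x%:P).

(* lambda_1 >= ... >= lambda_n : the Laplacian eigenvalues (chosen via epsilon;
   they exist and are unique since L(G) is real symmetric) *)
Definition lap_eigs (R : rcfType) (n : nat) (e : rel 'I_n) : seq R :=
  epsilon (inhabits [::]) (is_desc_spectrum (laplacian R e)).

Definition eigsum (R : rcfType) (n : nat) (e : rel 'I_n) (k : nat) : R :=
  \sum_(i < k) (lap_eigs R e)`_i.

(* Threshold graph: nodes can be ordered s 0, s 1, ..., s (n-1) (order of
   addition), where the node added at step j is isolated (b j = false) or
   adjacent to all previously added nodes (b j = true). *)
Definition is_threshold (n : nat) (e : rel 'I_n) : Prop :=
  exists (s : 'S_n) (b : 'I_n -> bool), forall i j : 'I_n,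
    e (s i) (s j) = (if (i < j)%N then b j else if (j < i)%N then b i else false).

Definition spectrally_threshold_dominated (R : rcfType) (n : nat) (e : rel 'I_n) : Prop :=
  forall k : nat, (1 <= k <= n)%N ->
    exists t : rel 'I_n, [/\ is_threshold t, nedges t = nedges e &
                            eigsum R e k <= eigsum R t k].

(* Main.v *)
(** A threshold graph built in the order 0, 1, ..., n-1 with bits b has m = sum of
    l * b_l edges, and its Laplacian is diagonalised by the vectors
    v_j = (1, ..., 1, -j, 0, ..., 0), j > 0, and the all-ones vector. The eigenvalue of
    v_j is (j + 1) b_j + #{l > j : b_l}, so the sum over j in S exceeds m by at most
    1 + 2 + ... + |S|: this bounds all threshold graphs by m + C(k+1, 2).

    Conversely the sum of the k largest eigenvalues of any graph is also at most 2m
    (trace and positivity) and kn (every eigenvalue is at most n), and some threshold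
    graph attains the smallest of the three bounds. For m <= C(k+1, 2), take bits in
    [1, k], which leaves at most k nonzero eigenvalues. For
    C(k+1, 2) <= m <= k(n-1) - C(k, 2), take the bits at k distinct integers of
    [1, n-1] with sum m. For larger m, let the last k nodes be dominating, which
    produces k eigenvalues equal to n. *)

Require Import Defs.
From Stdlib Require Import ClassicalEpsilon.
From mathcomp Require Import all_boot all_order all_algebra all_fingroup.
From mathcomp Require Import spectral complex zify ring.
Set Implicit Arguments. Unset Strict Implicit. Unset Printing Implicit Defensive.
Import Order.TTheory GRing.Theory Num.Theory.
Local Open Scope ring_scope.

(** * Ordered spectra of symmetric matrices *)

(** The scalar matrix of ['X] commutes with [P], so [P] intertwines the two characteristic matrices
    over polynomials. Taking determinants, the nonzero constant [\det P] cancels. *)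
Lemma char_poly_similar (F : fieldType) n (P A B : 'M[F]_n) :
  P \in unitmx -> P *m A = B *m P -> char_poly A = char_poly B.
Proof.
rewrite unitmxE unitfE => Pu PA.
have eqC : map_mx polyC P *m char_poly_mx A = char_poly_mx B *m map_mx polyC P.
  by rewrite mulmxBr mulmxBl -!map_mxM PA scalar_mxC.
have /eqP := congr1 determinant eqC.
by rewrite !det_mulmx mulrC det_map_mx (inj_eq (mulIf _)) ?polyC_eq0 // => /eqP.
Qed.

Lemma char_poly_diag (F : comNzRingType) n (d : 'rV[F]_n) :
  char_poly (diag_mx d) = \prod_(i < n) ('X - (d 0 i)%:P).
Proof.
rewrite char_poly_trig; last by apply: diag_mx_is_trig.
by apply: eq_bigr => i _; rewrite mxE eqxx.
Qed.

Lemma is_desc_spectrum_sort (R : rcfType) n (A : 'M[R]_n) (s : seq R) :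
  char_poly A = \prod_(x <- s) ('X - x%:P) ->
  exists t, is_desc_spectrum A t.
Proof.
move=> As; exists (sort (fun x y => y <= x) s); split.
  by apply: sort_sorted => x y; apply: le_total.
by rewrite As; apply: perm_big; rewrite perm_sym perm_sort.
Qed.

(** Over [R[i]] the matrix is hermitian, hence unitarily diagonalisable with a real diagonal. The
    resulting factorisation descends to [R] because coefficientwise embedding of polynomials is
    injective. *)
Lemma symmetric_spectrum_exists (R : rcfType) n (A : 'M[R]_n) :
  A^T = A -> exists s, is_desc_spectrum A s.
Proof.
move=> symA; pose toC : {rmorphism R -> R[i]} := real_complex R.
have hA : map_mx toC A \is hermsymmx.
  apply: realsym_hermsym.
    apply/is_hermitianmxP; rewrite expr0 scale1r map_mx_id //.
    by apply/matrixP => i j; rewrite !mxE -[in RHS]symA mxE.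
  by apply/mxOverP => i j; rewrite mxE; apply/complex_realP; exists (A i j).
have /mxOverP dreal := hermitian_spectral_diag_real hA.
have /hermitian_normalmx/orthomx_spectralP := hA.
set P := spectralmx _; set d := spectral_diag _ => Adef.
have Pu : P \in unitmx := spectral_unit _.
have PA : P *m map_mx toC A = diag_mx d *m P.
  by rewrite Adef -!mulmxA mulKVmx.
apply: (@is_desc_spectrum_sort _ _ _ [seq complex.Re (d 0 i) | i <- enum 'I_n]).
apply: (map_poly_inj toC).
rewrite map_char_poly (char_poly_similar Pu PA) char_poly_diag map_prod_XsubC.
rewrite big_map big_enum /=; apply: eq_bigr => i _.
by have /complex_realP [x ->] := dreal 0 i.
Qed.

Lemma laplacian_sym (R : nzRingType) n (e : rel 'I_n) :
  symmetric e -> (laplacian R e)^T = laplacian R e.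
Proof.
move=> se; apply/matrixP => i j; rewrite !mxE eq_sym.
by case: eqP => [->|_] //; rewrite se.
Qed.

Lemma lap_eigsP (R : rcfType) n (e : rel 'I_n) :
  symmetric e -> is_desc_spectrum (laplacian R e) (lap_eigs R e).
Proof.
move=> se; apply: epsilon_spec.
exact/symmetric_spectrum_exists/laplacian_sym.
Qed.

Lemma size_desc_spectrum (R : rcfType) n (A : 'M[R]_n) s :
  is_desc_spectrum A s -> size s = n.
Proof.
move=> [_ As]; apply: succn_inj.
by rewrite -(size_char_poly A) As size_prod_XsubC.
Qed.

Lemma desc_spectrum_trace (R : rcfType) n (A : 'M[R]_n) s :
  is_desc_spectrum A s -> \sum_(i < n) s`_i = \tr A.
Proof.
move=> As; have szs := size_desc_spectrum As; case: As => _ As.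
case: n => [|n] in A As szs *.
  by rewrite /mxtrace !big_ord0.
apply: oppr_inj; rewrite -char_poly_trace // As -szs.
by rewrite coefPn_prod_XsubC ?szs // [in RHS](big_nth 0) szs big_mkord.
Qed.

Lemma desc_spectrum_eigenvalue (R : rcfType) n (A : 'M[R]_n) s (i : 'I_n) :
  is_desc_spectrum A s -> eigenvalue A s`_i.
Proof.
move=> As; have szs := size_desc_spectrum As; case: As => _ As.
by rewrite eigenvalue_root_char As root_prod_XsubC mem_nth ?szs.
Qed.

Lemma desc_spectrum_antitone (R : rcfType) n (A : 'M[R]_n) s (i j : nat) :
  is_desc_spectrum A s -> (i <= j < n)%N -> s`_j <= s`_i.
Proof.
move=> As /andP[ij jn]; have szs := size_desc_spectrum As; case: As => sd _.
apply: (@sorted_leq_nth _ (fun x y : R => y <= x)) => //; rewrite ?inE ?szs //.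
- by move=> x y z xy yz; apply: le_trans yz xy.
- exact: leq_ltn_trans jn.
Qed.

(** Subtract the smallest of the top [k] values, [t], from every term: the differences are
    nonnegative inside the top block and nonpositive outside it. The correction [t *+ #|S|] is at
    most [t *+ k] since [t] is nonnegative. *)
Lemma desc_spectrum_topsum_ge (R : rcfType) n (A : 'M[R]_n) s (S : {set 'I_n}) k :
  is_desc_spectrum A s -> (forall i : 'I_n, 0 <= s`_i) ->
  (#|S| <= k <= n)%N -> \sum_(i in S) s`_i <= \sum_(i < k) s`_i.
Proof.
move=> As s0 /andP[Sk kn]; case: k => [|k] in Sk kn *.
  by move: Sk; rewrite leqn0 cards_eq0 => /eqP ->; rewrite big_set0 big_ord0.
pose t := s`_k.
have t0 : 0 <= t by apply: (s0 (Ordinal kn)).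
have -> : \sum_(i < k.+1) s`_i = \sum_(i < n | (i < k.+1)%N) (s`_i - t) + t *+ k.+1.
  rewrite -(big_ord_widen n (fun i => s`_i - t)) // sumrB sumr_const card_ord.
  by rewrite subrK.
have -> : \sum_(i in S) s`_i = \sum_(i in S) (s`_i - t) + t *+ #|S|.
  by rewrite sumrB sumr_const subrK.
apply: lerD; last exact: ler_wpMn2l.
rewrite [leLHS](bigID (fun i : 'I_n => (i < k.+1)%N)) /=.
rewrite [leRHS](bigID (mem S)) /=; apply: lerD.
  by rewrite le_eqVlt; apply/orP; left; apply/eqP/eq_bigl => i; rewrite andbC.
apply: (@le_trans _ _ 0).
  apply: sumr_le0 => i /andP[_]; rewrite -leqNgt => ki; rewrite subr_le0.
  by apply: desc_spectrum_antitone As _; rewrite ltnW //=.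
apply: sumr_ge0 => i /andP[ik _]; rewrite subr_ge0.
by apply: desc_spectrum_antitone As _; rewrite -ltnS ik.
Qed.

(** * The Laplacian quadratic form *)

Lemma sum_degree (n : nat) (e : rel 'I_n) :
  simple_graph e -> (\sum_i degree e i = (nedges e).*2)%N.
Proof.
move=> [se ie].
have dE : (\sum_i degree e i = \sum_i \sum_(j | e i j) 1)%N.
  by apply: eq_bigr => i _; rewrite /degree -sum1_card; apply: eq_bigl => j; rewrite inE.
have mE : nedges e = (\sum_(i < n) \sum_(j < n | (i < j)%N && e i j) 1)%N.
  by rewrite pair_big_dep /nedges -sum1_card; apply: eq_bigl => p; rewrite inE.
have -> : ((nedges e).*2 = \sum_(i < n) (\sum_(j < n | (i < j)%N && e i j) 1 +
                                   \sum_(j < n | (j < i)%N && e i j) 1))%N.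
  rewrite big_split /= -mE -addnn; congr addn.
  rewrite mE (exchange_big_dep xpredT) //=; apply: eq_bigr => i _.
  by apply: eq_bigl => j; rewrite se.
rewrite dE; apply: eq_bigr => i _.
rewrite (bigID (fun j : 'I_n => (i < j)%N)) /=; congr addn; apply: eq_bigl => j.
  by rewrite andbC.
rewrite andbC -leqNgt leq_eqVlt; case: eqP => //= ji.
by rewrite (val_inj ji) ie ltnn.
Qed.

Lemma laplacian_trace (R : nzRingType) (n : nat) (e : rel 'I_n) :
  simple_graph e -> \tr (laplacian R e) = (nedges e).*2%:R.
Proof.
move=> /sum_degree <-; rewrite natr_sum; apply: eq_bigr => i _.
by rewrite mxE eqxx.
Qed.

Lemma laplacian_mul_col (R : nzRingType) (n : nat) (e : rel 'I_n) (v : 'cV[R]_n) i :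
  irreflexive e ->
  (laplacian R e *m v) i 0 = \sum_j (e i j)%:R * (v i 0 - v j 0).
Proof.
move=> ie; rewrite mxE (bigD1 i) //= mxE eqxx.
under eq_bigr => j ji do rewrite mxE eq_sym (negPf ji) mulNr.
under [RHS]eq_bigr => j _ do rewrite mulrBr.
rewrite sumrB sumrN -mulr_suml; congr (_ * _ - _).
  by rewrite /degree -sum1_card natr_sum big_mkcond /=; apply: eq_bigr => j _;
     rewrite inE; case: (e i j).
by rewrite [RHS](bigD1 i) //= ie mul0r add0r.
Qed.

(** Each edge occurs in the double sum as two ordered pairs, hence the factor 2. Adding the terms of
    (i, j) and (j, i) completes the square. *)
Lemma laplacian_form (R : comNzRingType) (n : nat) (e : rel 'I_n) (v : 'cV[R]_n) :
  simple_graph e ->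
  (v^T *m laplacian R e *m v) 0 0 *+ 2 =
    \sum_i \sum_j (e i j)%:R * (v i 0 - v j 0) ^+ 2.
Proof.
move=> [se ie].
have -> : (v^T *m laplacian R e *m v) 0 0 =
    \sum_i \sum_j (e i j)%:R * (v i 0 * (v i 0 - v j 0)).
  rewrite -mulmxA mxE; apply: eq_bigr => i _.
  rewrite laplacian_mul_col // mxE mulr_sumr.
  by apply: eq_bigr => j _; rewrite mulrCA.
rewrite mulr2n {2}exchange_big /= -big_split; apply: eq_bigr => i _ /=.
rewrite -big_split; apply: eq_bigr => j _ /=; rewrite (se j i); ring.
Qed.

(** Evaluate the quadratic form at an eigenvector. It is a sum of squares, which gives the lower
    bound. Enlarging the sum to all pairs, as for the complete graph, gives at most 2n|v|^2 - 2(sum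
    of v)^2, hence the upper bound. *)
Lemma laplacian_eigenvalue_bounds (R : realFieldType) (n : nat) (e : rel 'I_n) (a : R) :
  simple_graph e -> eigenvalue (laplacian R e) a -> 0 <= a <= n%:R.
Proof.
move=> ge /eigenvalueP [u ua u0]; pose v := u^T.
have form : (v^T *m laplacian R e *m v) 0 0 = a * \sum_i v i 0 ^+ 2.
  rewrite trmxK ua -scalemxAl mxE; congr (_ * _); rewrite mxE.
  by apply: eq_bigr => i _; rewrite /v mxE expr2.
have norm0 : 0 < \sum_i v i 0 ^+ 2.
  rewrite lt_neqAle eq_sym sumr_ge0 ?andbT => [|i _]; last exact: sqr_ge0.
  apply: contra u0; rewrite psumr_eq0 => [/allP v0|i _]; last exact: sqr_ge0.
  apply/eqP/rowP => i; have := v0 i; rewrite mem_index_enum sqrf_eq0 /v !mxE.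
  by move=> /(_ isT)/eqP.
have := laplacian_form v ge; rewrite form => q.
have up : \sum_i \sum_j (e i j)%:R * (v i 0 - v j 0) ^+ 2 <=
          (n%:R * \sum_i v i 0 ^+ 2) *+ 2.
  apply: (@le_trans _ _ (\sum_i \sum_j (v i 0 - v j 0) ^+ 2)).
    apply: ler_sum => i _; apply: ler_sum => j _.
    by case: (e i j); rewrite ?mul1r // mul0r sqr_ge0.
  have -> : \sum_i \sum_j (v i 0 - v j 0) ^+ 2 =
     (n%:R * \sum_i v i 0 ^+ 2) *+ 2 - (\sum_i v i 0) ^+ 2 *+ 2.
    under eq_bigr => i _ do under eq_bigr => j _ do rewrite sqrrB.
    under eq_bigr => i _ do
      rewrite !big_split sumrN sumr_const card_ord sumrMnl -mulr_sumr /=.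
    rewrite !big_split /= sumrN !sumrMnl -mulr_suml sumr_const card_ord.
    by rewrite mulr_natl mulr2n; ring.
  by rewrite lerBlDr lerDl mulrn_wge0 // sqr_ge0.
apply/andP; split.
  rewrite -(pmulr_lge0 _ norm0) -(pmulrn_lge0 _ (ltn0Sn 1)) q.
  apply: sumr_ge0 => i _; apply: sumr_ge0 => j _.
  by rewrite mulr_ge0 ?ler0n ?sqr_ge0.
by rewrite -(ler_pM2r norm0) -(ler_pMn2r (ltn0Sn 1)) q.
Qed.

(** * Spectra of threshold graphs *)

(* The bit [b 0] has no effect. *)
Definition threshold_rel (n : nat) (b : nat -> bool) : rel 'I_n :=
  fun i j => if (i < j)%N then b j else if (j < i)%N then b i else false.

(** Index 0 stands for the all-ones eigenvector, so its value is set to 0 separately instead of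
    following the general formula. *)
Definition threshold_eig (n : nat) (b : nat -> bool) (j : nat) : nat :=
  if j == 0%N then 0%N else (j.+1 * b j + \sum_(j.+1 <= l < n) b l)%N.

Lemma threshold_rel_simple n b : simple_graph (threshold_rel (n := n) b).
Proof.
split=> [i j|i]; rewrite /threshold_rel ?ltnn //.
by case: ltngtP.
Qed.

Lemma nedges_threshold n b :
  nedges (threshold_rel (n := n) b) = (\sum_(0 <= l < n) l * b l)%N.
Proof.
have -> : nedges (threshold_rel (n := n) b) =
    (\sum_(i < n) \sum_(j < n | (i < j)%N && b j) 1)%N.
  rewrite pair_big_dep /nedges -sum1_card; apply: eq_bigl => p; rewrite inE.
  by rewrite /threshold_rel; case: ltnP.
rewrite (exchange_big_dep xpredT) //= big_mkord; apply: eq_bigr => j _.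
case: (b j); last by rewrite muln0 big_pred0 // => i; rewrite andbF.
rewrite muln1 (eq_bigl (fun i : 'I_n => (i < j)%N)); last by move=> i; rewrite andbT.
by rewrite -(big_ord_widen n (fun=> 1%N)) ?sum_nat_const ?card_ord ?muln1 // ltnW.
Qed.

(* The columns are eigenvectors common to all graphs [threshold_rel b]. *)
Definition threshold_basis (R : nzRingType) (n : nat) : 'M[R]_n :=
  \matrix_(i, j) if (j == 0 :> nat) || (i < j)%N then 1
                 else if i == j then - j%:R else 0.

Lemma threshold_basis_col_sum (R : nzRingType) (n : nat) (j : 'I_n) :
  (0 < j)%N -> \sum_i threshold_basis R n i j = 0.
Proof.
move=> j0; rewrite (bigID (fun i : 'I_n => (i < j)%N)) /=.
rewrite (eq_bigr (fun=> 1)) => [|i ij]; last by rewrite mxE ij orbT.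
rewrite -(big_ord_widen n (fun=> 1)) ?sumr_const ?card_ord; last exact: ltnW.
rewrite (bigD1 j) ?ltnn //= mxE eqn0Ngt j0 ltnn eqxx big1 ?addr0 ?subrr // => i.
by move=> /andP[/negPf ij /negPf nij]; rewrite mxE eqn0Ngt j0 ij nij.
Qed.

(** Column [j] is supported on rows up to [j], where the later column [k] is constantly 1.
    Orthogonality of the two columns thus reduces to the vanishing of a column sum. *)
Lemma threshold_basis_absorb (R : nzRingType) (n : nat) (i j k : 'I_n) :
  (0 < j < k)%N -> threshold_basis R n i j * threshold_basis R n i k =
                   threshold_basis R n i j.
Proof.
move=> /andP[j0 jk]; rewrite [X in _ * X]mxE; case: (ltnP i k) => [_|ki].
  by rewrite orbT mulr1.
have ji : (j < i)%N := leq_trans jk ki.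
by rewrite !mxE [j == 0 :> nat]eqn0Ngt j0 ltnNge (ltnW ji) -(inj_eq val_inj) gtn_eqF //= mul0r.
Qed.

(** The columns are pairwise orthogonal, so the Gram matrix is diagonal. Its entries are nonzero
    because column [j] has diagonal entry 1 or [- j%:R] with [j] positive. *)
Lemma threshold_basis_unit (R : realFieldType) (n : nat) :
  threshold_basis R n \in unitmx.
Proof.
set V := threshold_basis R n.
have VV : V^T *m V = diag_mx (\row_j \sum_i V i j ^+ 2).
  apply/matrixP => j k; rewrite !mxE; case: eqP => [->|/eqP jk].
    by rewrite mulr1n; apply: eq_bigr => i _; rewrite mxE expr2.
  rewrite mulr0n; under eq_bigr => i _ do rewrite mxE.
  wlog lt_jk : j k jk / (j < k)%N => [IH|].
    case: (ltngtP j k) => [|kj|/val_inj/eqP]; [exact: IH| |by rewrite (negPf jk)].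
    by under eq_bigr => i _ do rewrite mulrC; apply: IH; rewrite // eq_sym.
  have k0 : (0 < k)%N by case: (k : nat) lt_jk.
  case: (posnP j) => [j0|j0].
    rewrite -[RHS](threshold_basis_col_sum R k0); apply: eq_bigr => i _.
    by rewrite [V i j]mxE j0 mul1r.
  rewrite -[RHS](threshold_basis_col_sum R j0); apply: eq_bigr => i _.
  by rewrite threshold_basis_absorb ?j0.
have /(congr1 determinant) := VV; rewrite det_mulmx det_tr det_diag => dV.
rewrite unitmxE unitfE; apply/eqP => d0.
move/esym/eqP: dV; rewrite d0 mulr0 => /prodf_eq0 [j _]; rewrite mxE.
rewrite psumr_eq0 => [|i _]; last exact: sqr_ge0.
move=> /allP/(_ j); rewrite mem_index_enum sqrf_eq0 mxE ltnn eqxx orbF.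
by case: (eqVneq (j : nat) 0) => [_|j0] /(_ isT);
  rewrite ?oner_eq0 // oppr_eq0 pnatr_eq0 (negPf j0).
Qed.

Lemma threshold_laplacian_basis (R : comNzRingType) (n : nat) (b : nat -> bool) :
  laplacian R (threshold_rel (n := n) b) *m threshold_basis R n =
  threshold_basis R n *m diag_mx (\row_(j < n) (threshold_eig n b j)%:R).
Proof.
have [_ ie] := threshold_rel_simple n b; set V := threshold_basis R n.
apply/matrixP => i j; rewrite mul_mx_diag [RHS]mxE [X in _ * X]mxE.
have -> : (laplacian R (threshold_rel (n := n) b) *m V) i j =
    \sum_l (threshold_rel b i l)%:R * (V i j - V l j).
  have := laplacian_mul_col (col j V) i ie; rewrite {1}colE mulmxA -colE mxE => ->.
  by apply: eq_bigr => l _; rewrite !mxE.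
case: (posnP j) => [j0|j0].
  rewrite /threshold_eig j0 eqxx mulr0 big1 // => l _.
  by rewrite !mxE j0 eqxx subrr mulr0.
have c_sum : (\sum_(j.+1 <= l < n) b l)%:R = \sum_(l < n | (j < l)%N) (b l)%:R :> R.
  by rewrite natr_sum big_geq_mkord.
have VE l : V l j = if (l < j)%N then 1 else if l == j then - j%:R else 0.
  by rewrite mxE eqn0Ngt j0.
rewrite /threshold_eig eqn0Ngt j0 natrD natrM c_sum /=.
case: (ltngtP i j) => [ij|ji|/val_inj ij].
(* Row above [j]: among columns [l] up to [j] only [l = j] has a different value, contributing (j +
   1) b_j; each later [l] contributes b_l. *)
- rewrite VE ij mul1r (bigID (fun l : 'I_n => (j < l)%N)) /= addrC; congr (_ + _).
    rewrite (bigD1 j) ?ltnn //= big1 ?addr0 => [|l /andP[lj nlj]].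
      rewrite VE ltnn eqxx /threshold_rel ij opprK mulrC; congr (_ * _).
      by rewrite -natr1 addrC.
    rewrite -leqNgt leq_eqVlt -[_ == _ :> nat]/(l == j) (negPf nlj) /= in lj.
    by rewrite VE lj subrr mulr0.
  apply: eq_bigr => l jl; rewrite VE ltnNge (ltnW jl) /= -(inj_eq val_inj) gtn_eqF //.
  by rewrite /threshold_rel (ltn_trans ij jl) subr0 mulr1.
(* Row below [j]: node [i] is joined to all or none of the support of the column, so the sum is a
   multiple of the zero column sum. *)
- have Vij : V i j = 0 by rewrite VE ltnNge (ltnW ji) /= -(inj_eq val_inj) gtn_eqF.
  have := congr1 (fun x => - (b i)%:R * x) (threshold_basis_col_sum R j0).
  rewrite mulr0 Vij mul0r mulr_sumr => V0.
  rewrite -[RHS]V0; apply: eq_bigr => l _; rewrite sub0r mulrN mulNr; congr (- _).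
  case: (ltnP j l) => [jl|lj].
    have -> : V l j = 0 by rewrite VE ltnNge (ltnW jl) /= -(inj_eq val_inj) gtn_eqF.
    by rewrite !mulr0.
  have li := leq_ltn_trans lj ji.
  by rewrite /threshold_rel ltnNge (ltnW li) /= li.
(* Row [j]: each of the [j] earlier nodes contributes -(j + 1) b_j, and each later [l] contributes
   -j b_l. *)
- rewrite ij [V j j]VE ltnn eqxx mulrDr (bigID (fun l : 'I_n => (j < l)%N)) /= addrC.
  congr (_ + _); last first.
    rewrite mulr_sumr; apply: eq_bigr => l jl.
    rewrite VE ltnNge (ltnW jl) /= -(inj_eq val_inj) gtn_eqF //.
    by rewrite /threshold_rel jl subr0 mulrC.
  rewrite (bigD1 j) ?ltnn //= /threshold_rel ltnn mul0r add0r.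
  rewrite (eq_bigl (fun l : 'I_n => (l < j)%N)) => [|l]; last first.
    by rewrite -leqNgt ltn_neqAle andbC.
  rewrite (eq_bigr (fun=> - ((b j)%:R * j.+1%:R))) => [|l lj]; last first.
    rewrite VE lj ltnNge (ltnW lj) /= -mulrN -natr1 opprD; ring.
  rewrite -(big_ord_widen n (fun=> - ((b j)%:R * j.+1%:R))); last exact: ltnW.
  by rewrite sumr_const card_ord -mulr_natl; ring.
Qed.

Lemma char_poly_threshold (R : rcfType) (n : nat) (b : nat -> bool) :
  char_poly (laplacian R (threshold_rel (n := n) b)) =
  \prod_(j < n) ('X - (threshold_eig n b j)%:R%:P).
Proof.
have <- := char_poly_similar (threshold_basis_unit R n)
             (esym (threshold_laplacian_basis R n b)).
by rewrite char_poly_diag; apply: eq_bigr => j _; rewrite mxE.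
Qed.

Lemma degree_relabel (n : nat) (e : rel 'I_n) (s : 'S_n) i :
  degree (fun i j => e (s i) (s j)) i = degree e (s i).
Proof.
rewrite /degree -[RHS](card_imset _ (@perm_inj _ s^-1)); apply: eq_card => j.
rewrite inE -{2}[j](permK s) mem_imset ?inE //; exact: perm_inj.
Qed.

Lemma char_poly_laplacian_relabel (R : fieldType) (n : nat) (e : rel 'I_n) (s : 'S_n) :
  char_poly (laplacian R (fun i j => e (s i) (s j))) = char_poly (laplacian R e).
Proof.
apply/esym/(char_poly_similar (unitmx_perm R s)).
rewrite -row_permE -[in RHS](invgK s) -col_permE invgK.
apply/matrixP => i j; rewrite !mxE degree_relabel permKV.
by rewrite -[i == _](inj_eq (@perm_inj _ s)) permKV.
Qed.

Lemma nedges_relabel (n : nat) (e : rel 'I_n) (s : 'S_n) :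
  simple_graph e -> nedges (fun i j => e (s i) (s j)) = nedges e.
Proof.
move=> ge; have [se ie] := ge; apply: double_inj.
rewrite -!sum_degree //; last by split=> [i j|i]; rewrite ?ie // se.
rewrite [RHS](reindex_inj (@perm_inj _ s)); apply: eq_bigr => i _.
exact: degree_relabel.
Qed.

(** Bits indexed by all of [nat], false beyond the nodes, can be kept fixed in inductions on [n]. *)
Lemma is_thresholdP (n : nat) (t : rel 'I_n) :
  is_threshold t <->
  exists (s : 'S_n) (b : nat -> bool),
    forall i j, t (s i) (s j) = threshold_rel b i j.
Proof.
split=> [[s [b0 tE]]|[s [b tE]]]; last by exists s, (fun i : 'I_n => b i).
exists s, (fun l => oapp b0 false (insub l)) => i j.
by rewrite tE /threshold_rel !valK.
Qed.

(** The linear factors of the characteristic polynomial determine its roots up to order. The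
    permutation [p] sends a position in the sorted spectrum to the index of its eigenvector. *)
Lemma lap_eigs_threshold (R : rcfType) (n : nat) (t : rel 'I_n) (s : 'S_n) (b : nat -> bool) :
  (forall i j, t (s i) (s j) = threshold_rel b i j) ->
  exists p : 'S_n,
    [/\ nedges t = (\sum_(0 <= l < n) l * b l)%N,
        is_desc_spectrum (laplacian R t) (lap_eigs R t) &
        forall i : 'I_n, (lap_eigs R t)`_i = (threshold_eig n b (p i))%:R].
Proof.
move=> sE.
have st : simple_graph t.
  have [se ie] := threshold_rel_simple n b.
  split=> [i j|i]; rewrite -(permKV s i); last by rewrite sE.
  by rewrite -(permKV s j) !sE.
have nE : nedges t = nedges (threshold_rel (n := n) b).
  rewrite -(nedges_relabel s st) /nedges; congr #|pred_of_set _|.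
  by apply/setP => p; rewrite !inE sE.
have LE : laplacian R (fun i j => t (s i) (s j)) = laplacian R (threshold_rel (n := n) b).
  apply/matrixP => i j; rewrite !mxE sE /degree.
  by under eq_finset do rewrite sE.
have Pt := @lap_eigsP R n t st.1; have szt := size_desc_spectrum Pt.
have : perm_eq (lap_eigs R t) [tuple (threshold_eig n b j)%:R | j < n].
  apply: prod_XsubC_eq; have [_ <-] := Pt.
  by rewrite -(char_poly_laplacian_relabel R t s) LE char_poly_threshold /= big_map big_enum.
move=> /tuple_permP [p pE]; exists p; split=> //.
  by rewrite nE nedges_threshold.
by move=> i; rewrite pE -tnth_nth !tnth_mktuple.
Qed.

(** * Sums of threshold eigenvalues *)

Lemma threshold_eigS n b j : (j < n)%N ->
  threshold_eig n.+1 b j = (threshold_eig n b j + (0 < j) * b n)%N.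
Proof.
by move=> jn; rewrite /threshold_eig; case: j jn => //= j jn;
   rewrite big_nat_recr //= addnA mul1n.
Qed.

(** Adding node [n] raises the eigenvalue of every earlier nonzero index by b_n and creates the
    eigenvalue (n + 1) b_n. *)
Lemma threshold_eig_sumS n b (S : pred nat) :
  (\sum_(0 <= j < n.+1) S j * threshold_eig n.+1 b j =
   \sum_(0 <= j < n) S j * threshold_eig n b j
   + b n * (\sum_(0 <= j < n) (S j && (0 < j)))
   + (S n && (0 < n)) * (n.+1 * b n))%N.
Proof.
rewrite big_nat_recr //=; congr addn; last first.
  by rewrite /threshold_eig big_geq // addn0; case: (n) => [|n'] /=;
     rewrite ?andbT ?andbF ?muln0 ?mul0n.
rewrite big_distrr /= -big_split /=; apply: eq_big_nat => j /andP[_ jn].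
by rewrite threshold_eigS // mulnDr; case: (S j); case: (0 < j)%N; case: (b n).
Qed.

Lemma positive_count_le n (S : pred nat) :
  (\sum_(0 <= j < n) (S j && (0 < j)) <= n.-1)%N.
Proof.
elim: n => [|[|n] IH]; first by rewrite big_geq.
  by rewrite big_nat1 andbF.
by rewrite big_nat_recr //=; case: (S _ && _); lia.
Qed.

(** Induction on [n], with [K] the number of chosen nonzero indices so far. If node [n] is
    dominating, the left side gains [K] and the right side [n] when [n] is not chosen; when a
    positive [n] is chosen, both gain n + K + 1. If it is isolated, the left side gains nothing. *)
Lemma threshold_eig_sum_le n b (S : pred nat) :
  (\sum_(0 <= j < n) S j * threshold_eig n b j <=
   \sum_(0 <= l < n) l * b l + 'C((\sum_(0 <= j < n) (S j && (0 < j))).+1, 2))%N.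
Proof.
elim: n => [|n IH]; first by rewrite !big_geq.
rewrite threshold_eig_sumS ![in leqRHS]big_nat_recr //=.
move: IH (positive_count_le n S); set K := (\sum_(0 <= j < n) (S j && (0 < j)))%N.
case: (S n && (0 < n))%N; rewrite ?addn1 ?addn0 ?mul1n ?mul0n ?[in 'C(K.+2, 2)]binS ?bin1.
  by case: (b n); rewrite ?mul1n ?mul0n ?muln1 ?muln0; lia.
by case: (b n); rewrite ?mul1n ?mul0n ?muln1 ?muln0; lia.
Qed.

(** Choosing exactly the dominating indices makes every inductive step of [threshold_eig_sum_le] an
    equality. *)
Lemma threshold_eig_sum_dominating n b : ~~ b 0%N ->
  (\sum_(0 <= j < n) b j * threshold_eig n b j =
   \sum_(0 <= l < n) l * b l + 'C((\sum_(0 <= j < n) b j).+1, 2))%N.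
Proof.
move=> b0; have bE j : b j && (0 < j)%N = b j.
  by case: j => [|j]; rewrite ?andbT // (negPf b0).
elim: n => [|n IH]; first by rewrite !big_geq.
have KE : (\sum_(0 <= j < n) (b j && (0 < j)) = \sum_(0 <= j < n) b j)%N.
  by apply: eq_bigr => j _; rewrite bE.
rewrite threshold_eig_sumS IH bE KE.
rewrite ![in RHS]big_nat_recr //=.
case: (b n); rewrite /= ?addn1 ?addn0 ?mul1n ?mul0n ?muln1 ?muln0 ?addn0 //.
by rewrite [in RHS]binS bin1; lia.
Qed.

(** All nonzero eigenvalues are chosen, so the sum is the trace. Inductively, a set bit at [l] adds
    (l - 1) + (l + 1) = 2l. *)
Lemma threshold_eig_sum_support n (b : nat -> bool) (S : pred nat) :
  (forall l j, b l -> (0 < j <= l)%N -> S j) ->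
  (\sum_(0 <= j < n) S j * threshold_eig n b j = (\sum_(0 <= l < n) l * b l).*2)%N.
Proof.
move=> bS; elim: n => [|n IH]; first by rewrite !big_geq.
rewrite threshold_eig_sumS IH [in RHS]big_nat_recr //=.
case: (boolP (b n)) => bn; last by rewrite !muln0 mul0n !addn0.
case: n bn {IH} => [|n] bn; first by rewrite !big_geq // !andbF.
have -> : (\sum_(0 <= j < n.+1) (S j && (0 < j)) = n)%N.
  rewrite big_ltn // andbF add0n -[RHS]muln1 -[n in RHS]subn0 -[in RHS]subSS -sum_nat_const_nat.
  by apply: eq_big_nat => j /andP[j0 jn]; rewrite j0 (bS _ _ bn) // j0 ltnW.
by rewrite (bS _ _ bn) //=; lia.
Qed.

Lemma threshold_eig_full n (b : nat -> bool) j : (0 < j < n)%N ->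
  (forall l, (j <= l < n)%N -> b l) -> threshold_eig n b j = n.
Proof.
move=> /andP[j0 jn] bl; rewrite /threshold_eig eqn0Ngt j0 /= bl ?leqnn //.
rewrite (eq_big_nat _ _ (F2 := fun=> 1%N)) => [|l /andP[jl ln]].
  by rewrite sum_nat_const_nat; lia.
by rewrite bl // ln ltnW.
Qed.

(** * Sums of distinct integers *)

Lemma bin2_double n : ('C(n.+1, 2).*2 = n * n.+1)%N.
Proof. by elim: n => // n IH; rewrite binS bin1 doubleD IH; lia. Qed.

Lemma sum_bits_widen N n (b : nat -> bool) (F : nat -> nat) : (N <= n)%N ->
  (forall l, b l -> l < N)%N ->
  (\sum_(0 <= l < n) F l * b l = \sum_(0 <= l < N) F l * b l)%N.
Proof.
move=> Nn bN; rewrite (big_cat_nat _ (n := N)) //= [X in (_ + X)%N]big1_seq ?addn0 // => l.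
rewrite mem_index_iota => /= /andP[Nl _]; case: (boolP (b l)) => [/bN|]; last by rewrite muln0.
by rewrite ltnNge Nl.
Qed.

(** Greedy choice: the largest integer [N] is used exactly when the smaller ones cannot reach
    [m]. *)
Lemma distinct_sum N m : (m <= 'C(N, 2))%N ->
  exists b : nat -> bool, (forall l, b l -> 0 < l < N)%N /\
    (\sum_(0 <= l < N) l * b l = m)%N.
Proof.
elim: N m => [|N IH] m mN.
  by exists (fun=> false); split=> //; rewrite big_geq //; case: m mN.
have [mN'|mN'] := leqP m 'C(N, 2).
  have [b [bN bm]] := IH m mN'; exists b; split=> [l /bN|]; first by lia.
  by rewrite (sum_bits_widen _ (leqnSn N)) // => l /bN /andP[].
(* For positive [N], C(N, 2) is at least N - 1, so [m] beyond it is at least [N]. *)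
have Nm : (0 < N <= m)%N.
  case: N mN mN' {IH} => [|N]; first by rewrite !bin_small //; lia.
  by have := bin2_double N; nia.
have [|b [bN bm]] := IH (m - N)%N; first by move: mN; rewrite binS bin1; lia.
exists (fun l => (l == N) || b l); split=> [l /orP[/eqP ->|/bN]|]; [lia|lia|].
rewrite big_nat_recr //= eqxx muln1 -[RHS](subnK (_ : N <= m)%N); last by lia.
by rewrite -bm; congr addn; apply: eq_big_nat => l /andP[_ lN]; rewrite ltn_eqF.
Qed.

(** The two bounds are the sums of the [k] smallest and of the [k] largest integers in [1, N - 1];
    everything between is attained. In the induction the largest integer is left out whenever the
    bounds for the smaller range allow it. *)
Lemma distinct_sum_card N k m : (k < N)%N ->
  ('C(k.+1, 2) <= m)%N -> (m + 'C(k, 2) <= k * N.-1)%N ->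
  exists b : nat -> bool, [/\ (forall l, b l -> 0 < l < N)%N,
    (\sum_(0 <= l < N) l * b l = m)%N & (\sum_(0 <= l < N) b l = k)%N].
Proof.
elim: N k m => // N IH [|k] m kN lo up.
  exists (fun=> false); split=> //; rewrite big1 //; last by move=> l; rewrite muln0.
  by move: up; rewrite mul0n; lia.
have b2 : 'C(k.+2, 2) = ('C(k.+1, 2) + k.+1)%N by rewrite binS bin1 addnC.
have b1 : 'C(k.+1, 2) = ('C(k, 2) + k)%N by rewrite binS bin1 addnC.
have d1 := bin2_double k.
have [/andP[kN' up']|nup] := boolP ((k.+1 < N)%N && (m + 'C(k.+1, 2) <= k.+1 * N.-1)%N).
  have [b [bN bm bk]] := IH k.+1 m kN' lo up'.
  have bN' l : b l -> (l < N)%N by move=> /bN /andP[].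
  exists b; split=> [l /bN||]; first by lia.
    by rewrite (sum_bits_widen _ (leqnSn N)).
  under eq_bigr => l _ do rewrite -[b l : nat]mul1n.
  rewrite (sum_bits_widen (fun=> 1%N) (leqnSn N)) //.
  by under eq_bigr => l _ do rewrite mul1n.
have [|||b [bN bm bk]] := IH k (m - N)%N; [lia| | |].
(* Lower bound for the remainder: either every integer must be used, and [lo] suffices, or [m]
   exceeds the maximum reachable without [N]. *)
- by move: nup; rewrite negb_and -leqNgt -ltnNge => /orP[]; nia.
- by case: N kN up {IH nup} => // N; nia.
exists (fun l => (l == N) || b l); split=> [l /orP[/eqP ->|/bN]||]; [lia|lia| |].
  rewrite big_nat_recr //= eqxx muln1 -[RHS](subnK (_ : N <= m)%N); last by nia.
  by rewrite -bm; congr addn; apply: eq_big_nat => l /andP[_ lN]; rewrite ltn_eqF.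
rewrite big_nat_recr //= eqxx addn1 -bk; congr S.
by apply: eq_big_nat => l /andP[_ lN]; rewrite ltn_eqF.
Qed.

(** * Threshold domination *)

(** Comparison with the complete graph, which is the threshold graph with all bits set. *)
Lemma nedges_le (n : nat) (e : rel 'I_n) : (nedges e <= 'C(n, 2))%N.
Proof.
have -> : 'C(n, 2) = nedges (threshold_rel (n := n) xpredT).
  rewrite nedges_threshold; elim: n {e} => [|n IH]; first by rewrite big_geq.
  by rewrite binS bin1 big_nat_recr //= IH muln1.
apply/subset_leq_card/subsetP => p; rewrite !inE => /andP[lt_p _].
by rewrite /threshold_rel lt_p.
Qed.

Lemma eigsum_le_double_edges (R : rcfType) (n : nat) (e : rel 'I_n) k :
  simple_graph e -> (k <= n)%N -> eigsum R e k <= (nedges e).*2%:R.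
Proof.
move=> ge kn; have Pe := lap_eigsP R ge.1.
rewrite -(laplacian_trace R ge) -(desc_spectrum_trace Pe) /eigsum.
rewrite (big_ord_widen n (fun i => (lap_eigs R e)`_i)) //.
rewrite [leRHS](bigID (fun i : 'I_n => (i < k)%N)) /= lerDl.
apply: sumr_ge0 => i _.
by have /andP[] := laplacian_eigenvalue_bounds ge (desc_spectrum_eigenvalue i Pe).
Qed.

Lemma eigsum_le_order (R : rcfType) (n : nat) (e : rel 'I_n) k :
  simple_graph e -> (k <= n)%N -> eigsum R e k <= (k * n)%:R.
Proof.
move=> ge kn; have Pe := lap_eigsP R ge.1.
apply: (@le_trans _ _ (\sum_(i < k) n%:R)).
  apply: ler_sum => i _.
  have := desc_spectrum_eigenvalue (widen_ord kn i) Pe.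
  by move=> /(laplacian_eigenvalue_bounds ge)/andP[].
by rewrite sumr_const card_ord natrM mulr_natl.
Qed.

Lemma eigsum_threshold_le (R : rcfType) (n : nat) (t : rel 'I_n) k :
  is_threshold t -> (k <= n)%N ->
  eigsum R t k <= (nedges t)%:R + 'C(k.+1, 2)%:R.
Proof.
move=> /is_thresholdP [s [b tE]] kn.
have [p [-> _ pE]] := lap_eigs_threshold R tE.
(* [A] collects the eigenvector indices of the [k] largest eigenvalues; [S] is its indicator on
   [nat]. Discarding index 0 can only lower the count below [k]. *)
pose A := [set p (widen_ord kn i) | i : 'I_k].
pose S l := oapp (mem A) false (insub l).
have wi : injective (fun i => p (widen_ord kn i)).
  by move=> i j /perm_inj/(congr1 val) /= /val_inj.
have SE (j : 'I_n) : S j = (j \in A) by rewrite /S valK.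
have -> : eigsum R t k = (\sum_(0 <= j < n) S j * threshold_eig n b j)%N%:R.
  rewrite big_mkord natr_sum.
  transitivity (\sum_(j in A) (threshold_eig n b j)%:R : R).
    rewrite big_imset /= => [|i j _ _ /wi //]; apply: eq_bigr => i _.
    by rewrite -pE.
  rewrite big_mkcond; apply: eq_bigr => j _ /=.
  by rewrite SE; case: (j \in A); rewrite ?mul1n.
rewrite -natrD ler_nat; apply: leq_trans (threshold_eig_sum_le n b S) _.
rewrite leq_add2l; apply: leq_bin2l; rewrite ltnS.
apply: (@leq_trans #|A|); last by rewrite card_imset // card_ord.
rewrite -sum1_card big_mkord [leqRHS]big_mkcond /=; apply: leq_sum => j _.
by rewrite SE; case: (j \in A); case: (0 < j)%N.
Qed.

Lemma eigsum_threshold_ge (R : rcfType) (n k : nat) (b : nat -> bool) (S : pred nat) :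
  (\sum_(0 <= j < n) S j <= k <= n)%N ->
  exists t : rel 'I_n, [/\ is_threshold t,
    nedges t = (\sum_(0 <= l < n) l * b l)%N &
    (\sum_(0 <= j < n) S j * threshold_eig n b j)%N%:R <= eigsum R t k].
Proof.
move=> Sk; exists (threshold_rel b).
have tE i j : threshold_rel b ((1%g : 'S_n) i) ((1%g : 'S_n) j) = threshold_rel b i j.
  by rewrite !perm1.
have [p [mE Pt pE]] := lap_eigs_threshold R tE.
split=> //; first by apply/is_thresholdP; exists 1%g, b.
pose A := [set i : 'I_n | S (p i)].
have -> : (\sum_(0 <= j < n) S j * threshold_eig n b j)%N%:R =
    \sum_(i in A) (lap_eigs R (threshold_rel (n := n) b))`_i.
  rewrite big_mkord (reindex_inj (@perm_inj _ p)) natr_sum [RHS]big_mkcond /=.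
  by apply: eq_bigr => i _; rewrite inE pE; case: (S _); rewrite ?mul1n.
apply: desc_spectrum_topsum_ge Pt _ _ => [i|]; first by rewrite pE ler0n.
move: Sk; rewrite big_mkord (reindex_inj (@perm_inj _ p)) /= -sum1_card.
rewrite [in X in _ -> X]big_mkcond /=.
by under [in X in _ -> X]eq_bigr => i _ do rewrite inE.
Qed.

Lemma sum_consecutive a k :
  (\sum_(a <= l < a + k) l = k * a + 'C(k, 2))%N.
Proof.
elim: k => [|k IH]; first by rewrite addn0 big_geq.
by rewrite addnS big_nat_recr ?leq_addr //= IH binS bin1; lia.
Qed.

(** The bracket counts the edges created when [k] dominating nodes are added after [a] nodes. *)
Lemma bin2D a k : 'C(a + k, 2) = ('C(a, 2) + (k * a + 'C(k, 2)))%N.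
Proof.
elim: k => [|k IH]; first by rewrite mul0n bin0n !addn0.
by rewrite addnS !binS !bin1 IH mulSn; lia.
Qed.

Theorem theorem4 (R : rcfType) (n : nat) (e : rel 'I_n) :
  simple_graph e ->
  ((forall k : nat, (1 <= k <= n)%N ->
      eigsum R e k <= (nedges e)%:R + ('C(k.+1, 2))%:R)
   <-> spectrally_threshold_dominated R e).
Proof.
move=> ge; split=> [bound k kn|dom k kn]; last first.
  have [t [tt <- /le_trans]] := dom k kn; apply.
  by apply: eigsum_threshold_le => //; case/andP: kn.
have [k0 le_kn] := andP kn.
have mn := nedges_le e; set m := nedges e in mn.
suff [b [S [Sk bm Sb]]] : exists (b : nat -> bool) (S : pred nat),
    [/\ (\sum_(0 <= j < n) S j <= k)%N, (\sum_(0 <= l < n) l * b l = m)%N &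
        eigsum R e k <= (\sum_(0 <= j < n) S j * threshold_eig n b j)%N%:R].
  have [|t [tt tm tS]] := @eigsum_threshold_ge R n k b S; first by rewrite Sk.
  by exists t; split; rewrite ?tm ?bm //; apply: le_trans tS.
have [small|large] := leqP m 'C(k.+1, 2).
  (* Bits live in [1, N - 1]; the minimum keeps them both among the [n] nodes and within the first
     [k] nonzero indices. *)
  pose N := minn k.+1 n.
  have Nn : (N <= n)%N := geq_minr _ _.
  have mN : (m <= 'C(N, 2))%N by rewrite /N /minn; case: ifP.
  have [b [bN bm]] := distinct_sum mN.
  pose S j := (0 < j < N)%N; exists b, S; split.
  - rewrite (eq_bigr (fun j => 1 * S j)%N) => [|j _]; last by rewrite mul1n.
    rewrite (sum_bits_widen _ Nn) => [|l /andP[] //].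
    rewrite (eq_bigr (fun j => nat_of_bool (S j && (0 < j)%N))) => [|j _]; last first.
      by rewrite mul1n /S; case: (0 < j)%N; rewrite ?andbT.
    by apply: leq_trans (positive_count_le N S) _; rewrite /N; lia.
  - by rewrite (sum_bits_widen _ Nn) // => l /bN /andP[].
  - rewrite threshold_eig_sum_support => [|l j /bN]; last by rewrite /S; lia.
    rewrite (sum_bits_widen _ Nn) ?bm => [|l /bN /andP[] //].
    exact: eigsum_le_double_edges.
(* For k = n the count of all pairs would already put [m] in the first case. *)
have lt_kn : (k < n)%N.
  rewrite ltn_neqAle le_kn andbT; apply: contraTneq large => ->.
  by rewrite -leqNgt (leq_trans mn) // leq_bin2l.
have [mid|huge] := leqP (m + 'C(k, 2))%N (k * n.-1).
  have [b [bN bm bk]] := distinct_sum_card lt_kn (ltnW large) mid.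
  (* The dominating indices attain m + C(k + 1, 2) exactly; this is the case that relies on
     [bound]. *)
  exists b, b; split=> //; first by rewrite bk.
  rewrite threshold_eig_sum_dominating ?bk ?bm; last first.
    by apply/negP => /bN.
  by rewrite natrD; apply: bound.
pose a := (n - k)%N.
have nE : n = (a + k)%N by rewrite /a; lia.
have a0 : (0 < a)%N by rewrite /a; lia.
(* [top] is the sum of the positions a, ..., n - 1, the edges created by the last [k] nodes when
   dominating. The other m - top edges fit among the first [a] nodes. *)
pose top := (k * a + 'C(k, 2))%N.
have kE : (k * n.-1 = k * a + 'C(k, 2).*2)%N.
  case: (k) k0 nE => // k' _ nE; rewrite bin2_double [(k' * _)%N]mulnC -mulnDr.
  by rewrite nE addnS.
have m_top : (top <= m)%N by move: huge; rewrite kE /top; lia.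
have [|b [bN bm]] := @distinct_sum a (m - top).
  by rewrite leq_subLR addnC -bin2D -nE.
(* The chosen indices are the last [k]; they are nonzero by [a0], and each has eigenvalue [n]. *)
exists (fun l => (a <= l)%N || b l), (fun l => a <= l)%N.
have an : (a <= n)%N by rewrite nE leq_addr.
split.
- rewrite (big_cat_nat _ (n := a)) //= [X in (X + _)%N]big_nat_cond big1 => [|l]; last first.
    by rewrite andbT => /andP[_ la]; rewrite leqNgt la.
  rewrite (eq_big_nat _ _ (F2 := fun=> 1%N)) => [|l /andP[-> _] //].
  by rewrite sum_nat_const_nat; lia.
- rewrite (big_cat_nat _ (n := a)) //= (eq_big_nat _ _ (F2 := fun l => (l * b l)%N)); last first.
    by move=> l /andP[_ la]; rewrite leqNgt la.
  rewrite bm [X in (_ + X)%N](eq_big_nat _ _ (F2 := id)); last first.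
    by move=> l /andP[-> _]; rewrite muln1.
  by rewrite nE sum_consecutive subnK.
- rewrite (big_cat_nat _ (n := a)) //= [X in (X + _)%N]big_nat_cond big1 => [|l]; last first.
    by rewrite andbT => /andP[_ la]; rewrite leqNgt la.
  rewrite (eq_big_nat _ _ (F2 := fun=> n)) => [|l /andP[al ln]]; last first.
    rewrite al mul1n; apply: threshold_eig_full => [|j /andP[lj _]].
      by rewrite ln (leq_trans a0).
    by rewrite (leq_trans al).
  rewrite sum_nat_const_nat /a subKn //.
  exact: eigsum_le_order.
Qed.
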